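(* Let $b\geq 2$ be an integer and let $n>1$ be a divisor of $b^2+b-1$ (so that $b$ is invertible modulo $n$). Let $r$ be the multiplicative order of $b$ modulo $n$, suppose that $r>1$, and let $q$ be a prime power such that $n\mid (q-1)$. Let $L$ be the vector space $(\mathbb F_q)^r$ with basis $e_0,e_1,\dots,e_{r-1}$ and with the anti-commutative product defined on the basis by \begin{align*} \llbracket e_0,e_1\rrbracket&=e_{r-1},\\ \llbracket e_{i-1},e_i\rrbracket&=e_{i-2}\quad\text{for } i=2,3,\dots,r-1,\\ \llbracket e_{r-1},e_0\rrbracket&=e_{r-2},\\ \llbracket e_i,e_j\rrbracket&=0\quad\text{if } j-i\not\equiv\pm1\pmod r. \end{align*} Then $L$ is an $r$-dimensional simple IAC algebra.
   Context: An anti-commutative algebra over a field is a (not necessarily associative) algebra with product $\llbracket x,y\rrbracket$ satisfying $\llbracket x,x\rrbracket=0$ for all $x$. It is IAC if in addition its automorphism group acts irreducibly on the underlying vector space. It is simple if it is non-zero and its only ideals are $0$ and itself. *)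

(* Defs.v *)
From HB Require Import structures.
From mathcomp Require Import all_boot all_order all_algebra all_fingroup.
From mathcomp Require Import cyclic.

Set Implicit Arguments.
Unset Strict Implicit.
Unset Printing Implicit Defensive.

Import GRing.Theory.
Local Open Scope ring_scope.

Definition prime_power (q : nat) : Prop :=
  exists p k : nat, [/\ prime p, (0 < k)%N & q = (p ^ k)%N].

(* Meaningful for 1 < n and coprime b n; when b%:R is not a unit of 'Z_n,
   insubd falls back to 1, of order 1 (see mult_orderP). *)
Definition mult_order (n b : nat) : nat :=
  #[insubd (1%g : {unit 'Z_n}) (b%:R : 'Z_n)]%g.

Lemma mult_orderP (n b k : nat) : (1 < n)%N -> coprime b n ->
  (b ^ k == 1 %[mod n])%N = (mult_order n b %| k)%N.
Proof.
move=> n_gt1 co_bn; rewrite /mult_order.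
have b_unit : (b%:R : 'Z_n) \is a GRing.unit by rewrite unitZpE // coprime_sym.
rewrite order_dvdn -val_eqE FinRing.val_unitX insubdK //=.
rewrite -natrX -val_eqE.
by rewrite -(val_Zp_nat n_gt1 (b ^ k)) -(val_Zp_nat n_gt1 1).
Qed.

(* An algebra over F is a (finite-dimensional) vector space V together with a
   product mu : V -> V -> V. *)
Section Algebra.

Variables (F : fieldType) (V : vectType F).
Implicit Types (mu : V -> V -> V) (f : 'End(V)) (W I : {vspace V}).

Definition anticommutative_algebra mu : Prop :=
  bilinear_for *:%R *:%R mu /\ (forall x, mu x x = 0).

(* As V is finite-dimensional, a trivial kernel means bijectivity. *)
Definition algebra_automorphism mu f : Prop :=
  lker f = 0%VS /\ (forall x y, f (mu x y) = mu (f x) (f y)).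

Definition aut_irreducible mu : Prop :=
  fullv <> 0%VS :> {vspace V} /\
  forall W, (forall f, algebra_automorphism mu f -> (f @: W <= W)%VS) ->
    W = 0%VS \/ W = fullv.

Definition IAC_algebra mu : Prop :=
  anticommutative_algebra mu /\ aut_irreducible mu.

Definition algebra_ideal mu I : Prop :=
  forall x y, y \in I -> mu x y \in I /\ mu y x \in I.

Definition simple_algebra mu : Prop :=
  fullv <> 0%VS :> {vspace V} /\
  forall I, algebra_ideal mu I -> I = 0%VS \/ I = fullv.

End Algebra.

Section CyclicAlgebra.

Variables (F : fieldType) (r : nat).

Definition basis_vec (i : nat) : 'rV[F]_r := \row_j (nat_of_ord j == i)%:R.

(* ordS and ord_pred are the successor and predecessor modulo r.  The indices
   of the four defining relations are cyclic, so they all read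
   [e_i, e_(i+1)] = e_(i-1), together with anti-commutativity and 0 for
   non-adjacent indices; cyclic_mul_basis gives back their original form. *)
Definition basis_mul (i j : 'I_r) : 'rV[F]_r :=
  if j == ordS i then basis_vec (ord_pred i)
  else if i == ordS j then - basis_vec (ord_pred j)
  else 0.

Definition cyclic_mul (x y : 'rV[F]_r) : 'rV[F]_r :=
  \sum_(i < r) \sum_(j < r) (x 0 i * y 0 j) *: basis_mul i j.

Lemma cyclic_mul_ord (i j : 'I_r) :
  cyclic_mul (basis_vec i) (basis_vec j) = basis_mul i j.
Proof.
rewrite /cyclic_mul (bigD1 i) //= (bigD1 j) //= !mxE !eqxx mulr1 scale1r.
rewrite big1 ?addr0 => [|k /negPf nkj]; last first.
  by rewrite !mxE val_eqE nkj mulr0 scale0r.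
rewrite big1 ?addr0 // => k /negPf nki.
by rewrite big1 // => l _; rewrite !mxE val_eqE nki mul0r scale0r.
Qed.

Lemma cyclic_mul_basis : (2 < r)%N ->
  [/\ cyclic_mul (basis_vec 0) (basis_vec 1) = basis_vec (r - 1),
      forall i, (2 <= i < r)%N ->
        cyclic_mul (basis_vec (i - 1)) (basis_vec i) = basis_vec (i - 2),
      cyclic_mul (basis_vec (r - 1)) (basis_vec 0) = basis_vec (r - 2)
    & forall i j, (i < r)%N -> (j < r)%N ->
        (j != i + 1 %[mod r])%N -> (j + 1 != i %[mod r])%N ->
        cyclic_mul (basis_vec i) (basis_vec j) = 0].
Proof.
move=> r_gt2.
have succE i j (ir : (i < r)%N) (jr : (j < r)%N) :
    (j = i.+1 %% r)%N ->
    cyclic_mul (basis_vec i) (basis_vec j) = basis_vec ((i + r).-1 %% r).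
  move=> ji; rewrite (cyclic_mul_ord (Ordinal ir) (Ordinal jr)) /basis_mul.
  by rewrite -val_eqE /= -ji eqxx.
have r_gt0 : (0 < r)%N by apply: ltn_trans r_gt2.
have r_gt1 : (1 < r)%N by apply: ltn_trans r_gt2.
have predr_lt : (r - 1 < r)%N by rewrite ltn_subrL r_gt0.
have predr : (r - 1).+1 = r by rewrite subn1 prednK.
split.
- by rewrite (succE 0 1)%N ?modn_small ?add0n -?subn1.
- case=> [//|[//|i]] /andP[_ ir]; rewrite subn1 /= subSS subSS subn0.
  rewrite succE ?(ltnW ir) ?(modn_small ir) // addSn /= modnDr.
  by rewrite modn_small // (ltn_trans _ ir).
- rewrite succE ?predr ?modnn //.
  have -> : (r - 1 + r).-1 = (r - 2 + r)%N.
    by case: (r) r_gt2 => [|[|s]] // _; rewrite subn1 subSS subSS subn0 addSn.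
  by rewrite modnDr modn_small // ltn_subrL r_gt0.
- move=> i j ir jr nji nij.
  rewrite (cyclic_mul_ord (Ordinal ir) (Ordinal jr)) /basis_mul -!val_eqE /=.
  move: nji nij; rewrite !addn1 (modn_small ir) (modn_small jr) => /negPf->.
  by rewrite eq_sym => /negPf->.
Qed.

End CyclicAlgebra.

(* Main.v *)
Require Import Defs.
From mathcomp Require Import all_boot all_order all_algebra all_fingroup.
From mathcomp Require Import cyclic zify ring.

(** The congruence [b + b^2 = 1 (mod n)] says that the weights [b^i] satisfy
    [b^(i+1) + b^(i+2) = b^i], so for a primitive [n]-th root of unity [w] the
    diagonal map [e_i |-> w^(b^i) e_i] is an automorphism, and its eigenvalues
    are pairwise distinct.  A subspace stable under it is spanned by basis
    vectors, and the cyclic shift, another automorphism, permutes these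
    transitively.  For simplicity, the congruence also forces [r >= 4]; then
    multiplying a non-zero element of an ideal by two suitable basis vectors
    yields a non-zero multiple of a basis vector, and
    [e_i, e_(i+1)] = e_(i-1) generates all the others. *)

Set Implicit Arguments.
Unset Strict Implicit.
Unset Printing Implicit Defensive.

Import GRing.Theory.

(** * Cyclic indices *)

Lemma iter_ordS (r a : nat) (i : 'I_r) : iter a (@ordS r) i = (i + a) %% r :> nat.
Proof.
elim: a => [|a IHa] /=; first by rewrite addn0 modn_small.
by rewrite IHa -addn1 modnDml addn1 addnS.
Qed.

Lemma iter_ordS_neq (r a : nat) (i : 'I_r) : 0 < a < r ->
  iter a (@ordS r) i == i = false.
Proof.
move=> /andP[a_gt0 ltar]; apply/negbTE/negP => /eqP/(congr1 val)/= /eqP.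
rewrite iter_ordS -[X in _ == X](modn_small (ltn_ord i)) -[X in _ == X %% _]addn0.
by rewrite eqn_modDl modn_small // mod0n; case: a a_gt0 {ltar}.
Qed.

Lemma ord_pred_closed (r : nat) (P : 'I_r -> Prop) (k : 'I_r) :
  P k -> (forall i, P i -> P (ord_pred i)) -> forall i, P i.
Proof.
move=> Pk predP i.
suff [a <-]: exists a, iter a (@ord_pred r) k = i.
  by elim: a => //= a; apply: predP.
(* Going down from [k] by this many steps ends at [i - r], which is [i] modulo [r]. *)
exists (k + (r - i)).
have iterK a : cancel (iter a (@ordS r)) (iter a (@ord_pred r)).
  by elim: a => // a IHa j; rewrite iterSr /= ordSK IHa.
rewrite -[RHS](iterK (k + (r - i))); congr iter; apply: val_inj => /=.
rewrite iter_ordS addnCA subnKC ?(ltnW (ltn_ord i)) //.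
by rewrite modnDr modn_small.
Qed.

Local Open Scope ring_scope.

(** * The cyclic product in coordinates, simplicity, and the shift *)

Section CyclicMul.

Variables (F : fieldType) (r : nat).
Hypothesis r_gt2 : (2 < r)%N.
Local Notation mu := (@cyclic_mul F r).
Implicit Types (x y : 'rV[F]_r) (i j k : 'I_r).

(** Only [e_(k+1)] and [e_(k+2)] multiply to a multiple of [e_k]. The identities below are checked
    on this coordinate formula, not on the double sum. *)
Lemma cyclic_mulE x y k :
  mu x y 0 k = x 0 (ordS k) * y 0 (ordS (ordS k))
               - x 0 (ordS (ordS k)) * y 0 (ordS k).
Proof.
have basis_mulE i j : basis_mul F i j 0 k =
    ((i == ordS k) && (j == ordS (ordS k)))%:R
    - ((i == ordS (ordS k)) && (j == ordS k))%:R.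
  have ordSE (u v : 'I_r) : (u == ordS v) = (v == ord_pred u).
    by rewrite -[RHS](inj_eq (@ordS_inj r)) ord_predK eq_sym.
  (* As [r > 2], an index has distinct successor and predecessor, so the two non-zero cases of
     [basis_mul] exclude each other. *)
  have nS2 : ordS (ordS k) == k = false by apply: (@iter_ordS_neq r 2 k).
  rewrite /basis_mul; case: eqP => [->|jNSi].
    rewrite mxE val_eqE -ordSE !(inj_eq (@ordS_inj r)) andbb.
    by case: (i =P ordS (ordS k)) => [->|_]; rewrite ?nS2 subr0.
  case: eqP => [->|iNSj].
    rewrite !mxE val_eqE -ordSE !(inj_eq (@ordS_inj r)) andbb.
    by case: (j =P ordS (ordS k)) => [->|_]; rewrite ?nS2 ?andbF sub0r.
  rewrite mxE; case: andP => [[/eqP ei /eqP ej]|_]; first by case: jNSi; rewrite ei.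
  case: andP => [[/eqP ei /eqP ej]|_]; first by case: iNSj; rewrite ej.
  by rewrite subrr.
have pick2 (G : 'I_r -> 'I_r -> F) u v :
    \sum_i \sum_j G i j * ((i == u) && (j == v))%:R = G u v.
  rewrite (bigD1 u) //= [X in _ + X]big1 => [|i /negPf->]; last first.
    by rewrite big1 // => j _; rewrite mulr0.
  rewrite (bigD1 v) //= big1 => [|j /negPf->]; last by rewrite andbF mulr0.
  by rewrite !eqxx mulr1 !addr0.
rewrite -(pick2 (fun i j => x 0 i * y 0 j)).
rewrite -(pick2 (fun i j => x 0 i * y 0 j) (ordS (ordS k))).
rewrite /cyclic_mul summxE -sumrB; apply: eq_bigr => i _.
rewrite summxE -sumrB; apply: eq_bigr => j _.
by rewrite mxE basis_mulE mulrBr.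
Qed.

Lemma cyclic_mul_anticommutative : anticommutative_algebra mu.
Proof.
split=> [|x].
  by split=> z a x y; apply/rowP=> k; rewrite !(cyclic_mulE, mxE); ring.
by apply/rowP=> k; rewrite cyclic_mulE mxE; ring.
Qed.

Lemma cyclic_mul_delta k :
  mu (delta_mx 0 k) (delta_mx 0 (ordS k)) = delta_mx 0 (ord_pred k).
Proof.
apply/rowP=> i; rewrite cyclic_mulE !mxE !eqxx /= !(inj_eq (@ordS_inj r)).
have -> : (i == ord_pred k) = (ordS i == k).
  by rewrite -[LHS](inj_eq (@ordS_inj r)) ord_predK.
rewrite [X in _ - X](_ : _ = 0) ?subr0; first by case: eqP; rewrite ?mulr1 ?mulr0.
case: (i =P k) => [->|_]; last by rewrite mulr0.
have -> : ordS (ordS k) == k = false by apply: (@iter_ordS_neq r 2 k).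
by rewrite mul0r.
Qed.

(** Predecessors of [k] run through all indices. This closes both simplicity and irreducibility. *)
Lemma delta_closed_full (W : {vspace 'rV[F]_r}) k :
  delta_mx 0 k \in W ->
  (forall i, delta_mx 0 i \in W -> delta_mx 0 (ord_pred i) \in W) ->
  W = fullv.
Proof.
move=> kW predW; apply/vspaceP => x; rewrite memvf (row_sum_delta x).
apply: memv_suml => i _; apply: memvZ.
exact: (ord_pred_closed (P := fun i => delta_mx 0 i \in W) kW).
Qed.

Lemma vspace_eq0_or_coord_neq0 (W : {vspace 'rV[F]_r}) :
  W = 0%VS \/ exists2 x, x \in W & exists i, x 0 i != 0.
Proof.
case: (eqVneq W 0%VS) => [|W_neq0]; [by left|right].
exists (vpick W); first exact: memv_pick.
by apply/rV0Pn; rewrite vpick0.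
Qed.

Lemma fullv_neq0 : fullv <> 0%VS :> {vspace 'rV[F]_r}.
Proof.
move=> /(congr1 (fun U : {vspace _} => \dim U)).
by rewrite dimvf dim_matrix dimv0 mul1r => r0; have := r_gt2; rewrite r0.
Qed.

Lemma cyclic_mul_simple : (3 < r)%N -> simple_algebra mu.
Proof.
move=> r_gt3; split; first exact: fullv_neq0.
move=> I idealI; case: (vspace_eq0_or_coord_neq0 I) => [|[x xI [i xi]]]; first by left.
right; pose p := ord_pred (ord_pred (ord_pred i)).
have ip : i = ordS (ordS (ordS p)) by rewrite !ord_predK.
apply: (@delta_closed_full I p) => [|k kI]; last first.
  by rewrite -cyclic_mul_delta; case: (idealI (delta_mx 0 (ordS k)) _ kI).
(* Here [p] is [i - 3]. The inner product is [x_i e_(i-1) - x_(i+2) e_i]; multiplying by [e_(i-2)]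
   turns [e_(i-1)] into [- e_(i-3)] and, as [r >= 4], kills [e_i]. *)
pose z := mu (mu x (delta_mx 0 (ordS i))) (delta_mx 0 (ordS p)).
have zI : z \in I by do 2!apply: (idealI _ _ _).2.
suff zE : z = - x 0 i *: delta_mx 0 p.
  by move: zI; rewrite zE rpredZeq oppr_eq0 (negPf xi).
apply/rowP=> k; rewrite /z !cyclic_mulE !mxE !eqxx /= ip !(inj_eq (@ordS_inj r)).
have S1 (u : 'I_r) : ordS u == u = false.
  by apply: (@iter_ordS_neq r 1 u); rewrite (leq_trans _ r_gt3).
have S2 (u : 'I_r) : ordS (ordS u) == u = false.
  by apply: (@iter_ordS_neq r 2 u); rewrite (leq_trans _ r_gt3).
have S3 (u : 'I_r) : ordS (ordS (ordS u)) == u = false.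
  by apply: (@iter_ordS_neq r 3 u).
case: (k =P p) => [->|_].
  by rewrite S1 [p == ordS p]eq_sym S1 !mulr0 !mulr1 subr0 sub0r.
rewrite !mulr0 subr0; case: (ordS k =P p) => [<-|_]; last by rewrite mulr0.
by rewrite ![k == _]eq_sym S2 S3 !mulr0 subr0 mul0r.
Qed.

(** Precomposing coordinates with [ordS] sends [e_i] to [e_(i-1)], and [cyclic_mulE] has the same
    form at every index. *)
Lemma colsub_ordS_automorphism :
  algebra_automorphism mu (linfun (colsub (@ordS r) : 'rV[F]_r -> 'rV[F]_r)).
Proof.
split=> [|x y].
  apply/eqP/lker0P => x y; rewrite !lfunE => /rowP exy; apply/rowP => i.
  by have := exy (ord_pred i); rewrite !mxE ord_predK.
by rewrite !lfunE; apply/rowP => k; rewrite !(mxE, cyclic_mulE).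
Qed.

(** * Diagonal automorphisms and irreducibility *)

Section Diagonal.

Variable d : 'rV[F]_r.
Hypothesis d_neq0 : forall k, d 0 k != 0.
Hypothesis d_mul : forall k, d 0 (ordS k) * d 0 (ordS (ordS k)) = d 0 k.

(** Since [[e_(k+1), e_(k+2)] = e_k], the relation [d_mul] is what lets [e_k |-> d_k e_k] respect
    products. *)
Lemma diag_mx_automorphism :
  algebra_automorphism mu (linfun (mulmxr (diag_mx d) : 'rV[F]_r -> 'rV[F]_r)).
Proof.
split=> [|x y].
  apply/eqP/lker0P => x y; rewrite !lfunE /= !mul_mx_diag => /rowP exy.
  by apply/rowP => i; have := exy i; rewrite !mxE => /mulIf; apply.
rewrite !lfunE /= !mul_mx_diag; apply/rowP => k.
by rewrite !(mxE, cyclic_mulE) -d_mul; ring.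
Qed.

(* The weights [\prod_(j <- s) (d_i - d_j)] come from applying
   [\prod_(j <- s) (D - d_j)] to [x]; with [s] all indices but [k], only the
   [k]-th coordinate survives. *)
Lemma diag_stable_delta (W : {vspace 'rV[F]_r}) x k :
  injective (d 0) -> (linfun (mulmxr (diag_mx d)) @: W <= W)%VS ->
  x \in W -> x 0 k != 0 -> delta_mx 0 k \in W.
Proof.
move=> d_inj stabW xW xk.
have prodW (s : seq 'I_r) :
    \row_i (x 0 i * \prod_(j <- s) (d 0 i - d 0 j)) \in W.
  elim: s => [|j s IHs]; set v := \row_i _.
    by suff -> : v = x by []; apply/rowP => i; rewrite mxE big_nil mulr1.
  pose u := \row_i (x 0 i * \prod_(j <- s) (d 0 i - d 0 j)).
  have -> : v = linfun (mulmxr (diag_mx d)) u - d 0 j *: u.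
    rewrite lfunE /= mul_mx_diag; apply/rowP => i.
    by rewrite !mxE big_cons; ring.
  apply: memvB; last exact: memvZ.
  by apply: (subvP stabW); apply: memv_img.
have := prodW (rem k (enum 'I_r)).
set c := \prod_(j <- rem k (enum 'I_r)) (d 0 k - d 0 j).
have c_neq0 : c != 0.
  rewrite prodf_seq_neq0; apply/allP => j; rewrite mem_rem_uniq ?enum_uniq //.
  by rewrite inE => /andP[jk _]; rewrite /= subr_eq0 (inj_eq d_inj) eq_sym.
suff -> : \row_i (x 0 i * \prod_(j <- rem k (enum 'I_r)) (d 0 i - d 0 j))
          = (x 0 k * c) *: delta_mx 0 k.
  by rewrite rpredZeq mulf_eq0 (negPf xk) (negPf c_neq0).
apply/rowP => i; rewrite !mxE eqxx /=; case: eqP => [->|/eqP ik].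
  by rewrite mulr1.
have iin : i \in rem k (enum 'I_r) by rewrite mem_rem_uniq ?enum_uniq // inE ik mem_enum.
by rewrite (big_rem i iin) /= subrr mul0r !mulr0.
Qed.

Lemma cyclic_mul_IAC : injective (d 0) -> IAC_algebra mu.
Proof.
move=> d_inj; split; first exact: cyclic_mul_anticommutative.
split; first exact: fullv_neq0.
move=> W stabW; case: (vspace_eq0_or_coord_neq0 W) => [|[x xW [k xk]]]; first by left.
right; apply: (@delta_closed_full W k) => [|i iW].
  exact: diag_stable_delta (stabW _ diag_mx_automorphism) xW xk.
have := subvP (stabW _ colsub_ordS_automorphism) _ (memv_img _ iW).
rewrite lfunE; congr (_ \in W); apply/rowP => j.
by rewrite !mxE -[j == _](inj_eq (@ordS_inj r)) ord_predK.
Qed.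

End Diagonal.

End CyclicMul.

(** * Roots of unity in a finite field *)

Lemma finField_prim_root (F : finFieldType) (n : nat) :
  (n %| #|F|.-1)%N -> exists w : F, n.-primitive_root w.
Proof.
move=> n_dvd; have /cyclicP[u genu] := field_unit_group_cyclic [set: {unit F}].
(* It suffices to treat a generator [u] of the cyclic unit group; a power of it then has order
   [n]. *)
suff prim_u : (#|F|.-1).-primitive_root (val u : F).
  by exists (val u ^+ (#|F|.-1 %/ n)); apply: dvdn_prim_root.
have order_u : #[u]%g = #|F|.-1 by rewrite orderE -genu card_finField_unit.
rewrite -order_u; apply/andP; split; first exact: order_gt0.
(* The exponents [i.+1] tested are at most the order of [u], so only the order itself can be a
   multiple of it. *)
apply/forallP => i; rewrite unity_rootE -FinRing.val_unitX.
rewrite [X in X == _](inj_eq val_inj (u ^+ i.+1)%g 1%g) -order_dvdn.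
apply/eqP; case: eqP => [->|ne]; first exact: dvdnn.
apply/negP => /dvdn_leq - /(_ isT) le; apply: ne; apply/eqP.
by rewrite eqn_leq le andbT.
Qed.

Local Close Scope ring_scope.

(** * Arithmetic of the powers of [b] modulo [n] *)

Section Order.

Variables b n : nat.
Hypotheses (b_ge2 : 2 <= b) (n_gt1 : 1 < n) (n_dvd : n %| b ^ 2 + b - 1).

Lemma quadratic_coprime : coprime b n.
Proof.
rewrite /coprime -dvdn1; have gb := dvdn_gcdl b n.
have gf := dvdn_trans (dvdn_gcdr b n) n_dvd.
(* A common divisor of [b] and [n] divides both terms. *)
have -> : 1 = b * (b + 1) - (b ^ 2 + b - 1) by nia.
by apply: dvdn_sub => //; apply: dvdn_mulr.
Qed.

Lemma mult_order_dvd k : (n %| b ^ k - 1) = (mult_order n b %| k).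
Proof.
rewrite -mult_orderP ?quadratic_coprime // eqn_mod_dvd // expn_gt0.
by case: b b_ge2.
Qed.

(** Eliminating between [b^2 + b - 1] and [b^r - 1]: order 2 would give [n %| 1]; order 3 would give
    [n %| 2 * (b - 1)], hence [n %| b - 1] as [n] is odd, and so order 1. *)
Lemma mult_order_gt3 : 1 < mult_order n b -> 3 < mult_order n b.
Proof.
set r := mult_order n b => r_gt1.
have n1 : n %| 1 = false by rewrite dvdn1; case: n n_gt1 => [|[|]].
have ndvd k : n %| b ^ k - 1 -> r %| k by rewrite mult_order_dvd.
have dvdr := mult_order_dvd r; rewrite dvdnn in dvdr.
case: (ltngtP r 2) r_gt1 => // [r_gt2 _|r2 _].
  case: (ltngtP r 3) r_gt2 => // r3 _.
  (* [b^2 + b] is even, so [n] divides an odd number. *)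
  have odd_n : coprime n 2.
    have := n_dvd; rewrite coprime_sym coprime2n; apply: contraLR => nodd.
    apply/negP => /(dvdn_trans _) - /(_ 2); rewrite dvdn2 nodd => /(_ isT).
    rewrite dvdn2 oddB; last by nia.
    by rewrite oddD oddX /=; case: (odd b).
  have : n %| 2 * (b - 1).
    have -> : 2 * (b - 1) = (b ^ 3 - 1) - (b - 1) * (b ^ 2 + b - 1) by nia.
    by apply: dvdn_sub; [rewrite -r3|apply: dvdn_mull].
  rewrite Gauss_dvdr // -{1}[b]expn1 => /ndvd; rewrite r3 //.
have : n %| 1; last by rewrite n1.
have -> : 1 = b * (b ^ 2 + b - 1) - (b + 1) * (b ^ 2 - 1) by nia.
by apply: dvdn_sub; [apply: dvdn_mull|rewrite -{1}r2; apply: dvdn_mull].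
Qed.

(** Cancelling the unit [b^i] leaves [n %| b^(j-i) - 1], so the order divides [j - i], which is
    smaller. This makes the eigenvalues distinct. *)
Lemma eqn_exp_mod i j : i < mult_order n b -> j < mult_order n b ->
  b ^ i = b ^ j %[mod n] -> i = j.
Proof.
wlog le_ij : i j / i <= j => [wl ir jr eij|].
  by case: (leqP i j) => [|/ltnW] le; [|symmetry]; apply: wl.
move=> _ jr /esym/eqP; rewrite eqn_mod_dvd ?leq_exp2l // -{1}(subnK le_ij) expnD.
rewrite -[X in _ - X]mul1n -mulnBl Gauss_dvdl; last first.
  by rewrite coprime_sym coprimeXl ?quadratic_coprime.
rewrite mult_order_dvd; case: (posnP (j - i)) => [|ji_gt0 /dvdn_leq]; first by lia.
by move=> /(_ ji_gt0); lia.
Qed.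

(** The wrap-around of [ordS] is harmless because [b^r] is 1 modulo [n]; the rest is [b^i] times
    [b + b^2 = 1]. *)
Lemma quadratic_weights (i : 'I_(mult_order n b)) :
  b ^ ordS i + b ^ ordS (ordS i) = b ^ i %[mod n].
Proof.
set r := mult_order n b.
have br : b ^ r = 1 %[mod n] by apply/eqP; rewrite mult_orderP ?quadratic_coprime.
have bmod m : b ^ (m %% r) = b ^ m %[mod n].
  rewrite [in RHS](divn_eq m r) expnD [_ %/ _ * _]mulnC expnM.
  have brX k : (b ^ r) ^ k = 1 %[mod n] by rewrite -modnXm br modnXm exp1n.
  by rewrite -modnMml brX modnMml mul1n.
rewrite (iter_ordS 1 i) (iter_ordS 2 i) -modnDm !bmod modnDm !expnD.
have -> : b ^ i * b ^ 1 + b ^ i * b ^ 2 = b ^ i * (b ^ 2 + b - 1) + b ^ i by nia.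
by rewrite -modnDml; have /eqP-> := dvdn_mull (b ^ i) n_dvd.
Qed.

End Order.

(** * Assembly over the field with [q] elements *)

Theorem corollary6p3 (b n r q : nat) (F : finFieldType)
    (hb : (2 <= b)%N) (hn : (1 < n)%N) (hdvd : (n %| b ^ 2 + b - 1)%N)
    (hr : r = mult_order n b) (hr1 : (1 < r)%N)
    (hq : prime_power q) (hnq : (n %| q - 1)%N) (hF : #|F| = q) :
  \dim (fullv : {vspace 'rV[F]_r}) = r /\
  simple_algebra (@cyclic_mul F r) /\
  IAC_algebra (@cyclic_mul F r).
Proof.
move: hr1; rewrite {}hr => /(mult_order_gt3 hb hn hdvd) r_gt3.
split; first by rewrite dimvf dim_matrix mul1r.
have r_gt2 := ltnW r_gt3.
split; first exact: cyclic_mul_simple.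
have [w prim_w] : exists w : F, (n.-primitive_root w)%R.
  by apply: finField_prim_root; rewrite hF -subn1.
pose d : 'rV[F]_(mult_order n b) := (\row_i w ^+ (b ^ i))%R.
(* As [w] has order [n], the product relation and the injectivity of [d] become statements on
   exponents modulo [n]. *)
apply: (@cyclic_mul_IAC _ _ r_gt2 d) => [k|k|i j].
- by rewrite mxE expf_neq0 // (prim_root_eq0 prim_w); case: (n) hn.
- rewrite !mxE -exprD; apply/eqP; rewrite (eq_prim_root_expr prim_w).
  by rewrite (quadratic_weights hb hn hdvd).
rewrite !mxE => /eqP; rewrite (eq_prim_root_expr prim_w) => /eqP eij.
by apply: val_inj; apply: (eqn_exp_mod hb hn hdvd) eij.
Qed.
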